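(* Let $q$, $a$ and $b$ be integers such that $q \geq 2$, $a \geq 1$ and $b \geq -a$, and let $(v_n)_{n \in \mathbb{N}}$ be the sequence of natural numbers whose general term is $v_n = a q^n + b$ for all $n \in \mathbb{N}$. Suppose that $\gcd(a q, b) = \gcd(a + b, q - 1) = 1$ and set $$A' := \max\left(0, \frac{b}{2 a} + \frac{1}{2 a (q - 1)}\right).$$ Then, for any positive integer $n$, we have $$\mathrm{lcm}\{v_1, v_2, \dots, v_n\} \geq (a q + b) \left(\frac{a (q - 1) + 1}{\sqrt{a (q - 1)}\,(A' + 1)}\right)^{n - 1} q^{\frac{(n - 1)(n - 4)}{4}}.$$
   Context: $\mathbb{N}$ is the set of non-negative integers. *)

(* Defs.v *)
From mathcomp Require Import all_boot all_order all_algebra.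
From mathcomp Require Import reals.

Set Implicit Arguments.
Unset Strict Implicit.
Unset Printing Implicit Defensive.

Import Order.TTheory GRing.Theory Num.Theory.
Local Open Scope ring_scope.

Definition Aprime (R : realType) (q a b : int) : R :=
  Num.max 0 (b%:~R / (2 * a%:~R) + 1 / (2 * a%:~R * (q%:~R - 1))).

(* lcm {v_1, ..., v_n}: the index starts at 1, so v_0 is not included. *)
Definition lcm_upto (v : nat -> nat) (n : nat) : nat :=
  \big[lcmn/1%N]_(1 <= i < n.+1) v i.

(* Main.v *)
(* With r = a (q - 1) and c = a + b one has v_n = r [n]_q + c, where [n]_q is the
   q-integer, and v_(k+m) - v_k = r q^k [m]_q.  All the terms are coprime to r and
   q, so an induction on m shows that v_k ... v_(k+m) divides [m]_q! D for every
   common multiple D of these terms.  Bounding v_(k+i) / [i+1]_q below by r q^(k-1)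
   for i < m, and choosing k close to n / 2, gives
     lcm >= v_n r^ceil(N/2) q^(floor(N/2) ceil(N/2)),  N = n - 1,
   and comparing fourth powers, in order to remove the square root and the
   division by 4, yields the claim.  The factor 1 / (A' + 1) is only needed when
   a = 1, q = 2 and b > 0. *)
Require Import Defs.
From mathcomp Require Import all_boot all_order all_algebra.
From mathcomp Require Import reals exp.
From mathcomp Require Import zify ring lra.

Set Implicit Arguments.
Unset Strict Implicit.
Unset Printing Implicit Defensive.

Import Order.TTheory GRing.Theory Num.Theory.
Local Open Scope ring_scope.

(** * q-integers and q-factorials *)

Definition qint (q n : nat) : nat := (\sum_(j < n) q ^ j)%N.

Definition qfact (q n : nat) : nat := (\prod_(i < n) qint q i.+1)%N.

Lemma qintS (q n : nat) : qint q n.+1 = (qint q n + q ^ n)%N.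
Proof. by rewrite /qint big_ord_recr. Qed.

Lemma qintD (q k m : nat) : qint q (k + m) = (qint q k + q ^ k * qint q m)%N.
Proof.
elim: m => [|m IHm]; first by rewrite addn0 {3}/qint big_ord0 muln0 addn0.
by rewrite addnS !qintS IHm expnD mulnDr addnA.
Qed.

(** Geometric sum, with the base written [p.+1] to avoid truncated subtraction. *)
Lemma qintE (p n : nat) : (p * qint p.+1 n).+1 = (p.+1 ^ n)%N.
Proof.
elim: n => [|n IHn]; first by rewrite /qint big_ord0 muln0.
by rewrite qintS mulnDr -addSn IHn expnS mulSn.
Qed.

Lemma qint_gt0 (q n : nat) : (0 < qint q n.+1)%N.
Proof. by rewrite -[n.+1]add1n qintD /qint big_ord1 expn0. Qed.

Lemma qfact_gt0 (q n : nat) : (0 < qfact q n)%N.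
Proof. by apply: prodn_gt0 => i; apply: qint_gt0. Qed.

(** * Common multiples of consecutive terms [r [n]_q + c] *)

Section QArithmeticProgression.

Variables q r c : nat.

Definition qarith (n : nat) : nat := (r * qint q n + c)%N.

Lemma qarithD (k m : nat) :
  qarith (k + m) = (qarith k + r * q ^ k * qint q m)%N.
Proof. by rewrite /qarith qintD mulnDr -!mulnA addnAC. Qed.

Hypothesis coprime_rc : coprime r c.
Hypothesis coprime_q : coprime q (r + c).

Lemma coprime_qarith_r (k : nat) : coprime (qarith k) r.
Proof. by rewrite coprime_sym /coprime /qarith mulnC gcdnMDl. Qed.

(** Every term of positive index is congruent to [r + c] modulo [q]; the term of index 0 is [c],
    which may share a factor with [q]. *)
Lemma coprime_qarith_q (k : nat) : coprime (qarith k.+1) q.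
Proof.
rewrite -[k.+1]add1n qarithD expn1 coprime_sym /coprime -mulnA mulnCA addnC.
by rewrite mulnC gcdnMDl /qarith /qint big_ord1 expn0 muln1.
Qed.

(* The two products obtained by dropping one of the end terms [x], [y] divide
   [qfact q m * D], so the full product divides [qfact q m * D * (y - x)], and
   [y - x = r * q ^ k.+1 * qint q m.+1] whose first two factors are coprime to
   every term. *)
Lemma prod_qarith_dvdn (D k m : nat) :
  (forall i, (i <= m)%N -> (qarith (k.+1 + i) %| D)%N) ->
  (\prod_(i < m.+1) qarith (k.+1 + i) %| qfact q m * D)%N.
Proof.
elim: m k => [|m IHm] k hD.
  by rewrite big_ord1 /qfact big_ord0 mul1n; apply: hD.
have h1 := IHm k (fun i hi => hD i (leqW hi)).
have h2 : (\prod_(i < m.+1) qarith (k.+2 + i) %| qfact q m * D)%N.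
  by apply: IHm => i hi; rewrite addSnnS hD.
set N := (qfact q m * D)%N in h1 h2.
have -> : (qfact q m.+1 * D = N * qint q m.+1)%N.
  by rewrite /qfact big_ord_recr /= mulnAC.
have eq1 : (\prod_(i < m.+2) qarith (k.+1 + i) =
            (\prod_(i < m.+1) qarith (k.+1 + i)) * qarith (k.+1 + m.+1))%N.
  by rewrite big_ord_recr.
have eq2 : (\prod_(i < m.+2) qarith (k.+1 + i) =
            qarith k.+1 * \prod_(i < m.+1) qarith (k.+2 + i))%N.
  rewrite big_ord_recl addn0; congr (_ * _)%N.
  by apply: eq_bigr => i _; rewrite lift0 -addSnnS.
have cop : coprime (\prod_(i < m.+2) qarith (k.+1 + i)) (r * q ^ k.+1).
  rewrite coprime_sym; apply: (big_rec (fun x => coprime (r * q ^ k.+1) x)).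
    exact: coprimen1.
  move=> i x _ hx; rewrite coprimeMr hx andbT coprime_sym coprimeMr.
  by rewrite coprime_qarith_r coprimeXr // addSn coprime_qarith_q.
rewrite -(Gauss_dvdr _ cop) mulnCA.
have d1 : (\prod_(i < m.+2) qarith (k.+1 + i) %| N * qarith (k.+1 + m.+1))%N.
  by rewrite eq1 dvdn_mul.
have d2 : (\prod_(i < m.+2) qarith (k.+1 + i) %| N * qarith k.+1)%N.
  by rewrite eq2 mulnC dvdn_mul.
by move: d1; rewrite qarithD mulnDr dvdn_addr.
Qed.

Lemma qarith_lcm_bound (D k m : nat) : (0 < D)%N ->
  (forall i, (i <= m)%N -> (qarith (k.+1 + i) %| D)%N) ->
  (r ^ m * q ^ (k * m) * qarith (k + m).+1 <= D)%N.
Proof.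
move=> D0 hD; have := prod_qarith_dvdn hD.
move/(dvdn_leq (_ : 0 < qfact q m * D)%N).
rewrite muln_gt0 qfact_gt0 D0 => /(_ isT); rewrite big_ord_recr /= addSn => le.
rewrite -(leq_pmul2l (qfact_gt0 q m)); apply: leq_trans le.
rewrite mulnA leq_mul2r; apply/orP; right.
(* The power becomes a product over [i < m], to be compared factor by factor: [r * q ^ k * [i+1]_q]
   is one summand of the term of index [k + i.+1]. *)
rewrite expnM -expnMn -[m in (_ ^ m)%N]card_ord -prod_nat_const /qfact.
rewrite -big_split /=; apply: leq_prod => i _.
rewrite addSnnS /qarith qintD mulnDr; lia.
Qed.

End QArithmeticProgression.

Lemma dvdn_lcm_upto (v : nat -> nat) (n i : nat) :
  (0 < i)%N -> (i <= n)%N -> (v i %| lcm_upto v n)%N.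
Proof.
move=> i0 iln; rewrite /lcm_upto (bigD1_seq i) ?iota_uniq //=.
  exact: dvdn_lcml.
by rewrite mem_index_iota i0 ltnS.
Qed.

Lemma lcm_upto_gt0 (v : nat -> nat) (n : nat) :
  (forall i, (0 < i)%N -> 0 < v i)%N -> (0 < lcm_upto v n)%N.
Proof.
move=> v0; rewrite /lcm_upto big_nat; apply: (big_ind (fun x => 0 < x)%N) => //.
  by move=> x y x0 y0; rewrite lcmn_gt0 x0.
by move=> i /andP[i0 _]; apply: v0.
Qed.

(** * Passage to fourth powers *)

Lemma half_uphalf_sqr (N : nat) :
  (N * N = 4 * (N./2 * uphalf N) + odd N)%N /\
  (4 * uphalf N = 2 * N + 2 * odd N)%N.
Proof.
rewrite uphalf_half; have := odd_double_half N.
by move: N./2 (odd N) => k [] <-; rewrite -addnn; lia.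
Qed.

(* With [D] playing the role of the least common multiple, [y] that of [A'] and
   [r = a (q - 1)]; only the case [r = 1] needs a gain from the last term or
   from [y]. *)
Lemma fourth_power_bound (R : realFieldType) (q r c D N : nat) (y : R) :
  (1 < q)%N -> (0 < r)%N -> (q <= r.+1)%N ->
  (r ^ uphalf N * q ^ (N./2 * uphalf N) * qarith q r c N.+1 <= D)%N ->
  0 <= y -> (r = 1%N -> c = 0%N \/ 1 <= y) ->
  (r%:R + 1) ^+ (4 * N) * q%:R ^+ (N * N) * (r + c)%:R ^+ 4
  <= D%:R ^+ 4 * q%:R ^+ (3 * N) * r%:R ^+ (2 * N) * (y + 1) ^+ (4 * N) :> R.
Proof.
(* In the fourth power of [r ^ m * q ^ (k * m)], the exponent of [q] is [N * N - odd N] and that of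
   [r] is [2 * N + 2 * odd N]. *)
have [eN em] := half_uphalf_sqr N.
set k := N./2 in eN *; set m := uphalf N in eN em *.
move=> q1 r0 qr hD y0 hr1.
have o1 : (odd N <= N)%N by case: (N) => // ?; apply: leq_trans (leq_b1 _) _.
have last_ge : (r + c <= qarith q r c N.+1)%N.
  by rewrite leq_add2r leq_pmulr ?qint_gt0.
have hD1 : (r ^ m * q ^ (k * m) * (r + c) <= D)%N.
  by apply: leq_trans hD; rewrite leq_mul2l last_ge orbT.
have [r1|r2] := leqP r 1.
  have re : r = 1%N by lia.
  have qe : q = 2%N by lia.
  subst r q; rewrite exp1n mul1n in hD1.
  have e2 : (2 ^ (4 * N) * 2 ^ (N * N) <=
             (2 ^ (k * m)) ^ 4 * 2 ^ (3 * N) * 2 ^ (4 * N))%N.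
    by rewrite -expnM -!expnD leq_exp2l //; lia.
  rewrite expr1n mulr1.
  have [c0|y1] := hr1 erefl.
    (* For [c = 0] the last term is [2 ^ N.+1 - 1], at least [2 ^ N]; its fourth power absorbs
       [(r + 1) ^ (4 * N)]. *)
    have hD2 : (2 ^ (k * m) * 2 ^ N <= D)%N.
      apply: leq_trans hD; rewrite exp1n mul1n leq_mul2l; apply/orP; right.
      by rewrite /qarith qintS mul1n c0 addn0 leq_addl.
    have : ((1 + 1) ^ (4 * N) * 2 ^ (N * N) * (1 + c) ^ 4 <=
            D ^ 4 * 2 ^ (3 * N))%N.
      rewrite c0 exp1n muln1; apply: (leq_trans e2).
      rewrite mulnAC leq_mul2r [(4 * N)%N]mulnC [(2 ^ (N * 4))%N]expnM -expnMn.
      by rewrite leq_exp2r // hD2 orbT.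
    rewrite -(ler_nat R) !(natrM, natrX, natrD) => h.
    apply: (le_trans h); rewrite ler_peMr ?mulr_ge0 ?exprn_ge0 //.
    by rewrite exprn_ege1 // lerDr.
  (* Here [y + 1 >= 2] absorbs that factor instead. *)
  have : (2 ^ (4 * N) * 2 ^ (N * N) * (1 + c) ^ 4 <=
          D ^ 4 * 2 ^ (3 * N) * 2 ^ (4 * N))%N.
    apply: (leq_trans (leq_mul e2 (leqnn _))).
    rewrite [X in (X <= _)%N]mulnAC leq_mul2r [X in (X <= _)%N]mulnAC.
    by rewrite leq_mul2r -expnMn leq_exp2r // hD1 !orbT.
  rewrite -(ler_nat R) !(natrM, natrX) => h.
  apply: (le_trans h); rewrite ler_wpM2l ?mulr_ge0 ?exprn_ge0 //.
  by rewrite lerXn2r ?nnegrE ?addr_ge0 //; lra.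
(* Since [r >= 2], [((r + 1) / r) ^ 4] is at most [81 / 16], which is below [8 <= q ^ 3]. *)
have h4 : (r.+1 ^ 4 <= r ^ 4 * q ^ 3)%N.
  have : (2 ^ 4 * r.+1 ^ 4 <= 3 ^ 4 * r ^ 4)%N.
    by rewrite -!expnMn leq_exp2r //; lia.
  have : (2 ^ 3 <= q ^ 3)%N by rewrite leq_exp2r.
  nia.
have hX : (q ^ (N * N) * r ^ (2 * N) <= (r ^ m * q ^ (k * m)) ^ 4)%N.
  rewrite eN expnMn -!expnM [(m * 4)%N]mulnC em [(k * m * 4)%N]mulnC
    (expnD q _ (odd N)) (expnD r _ (2 * odd N)).
  (* For odd [N], the missing factor [q] is paid for by the surplus [r ^ 2], as
     [q <= r + 1 <= r ^ 2]. *)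
  have ho : (q ^ odd N <= r ^ (2 * odd N))%N by case: (odd N) => //=; nia.
  rewrite mulnAC [X in (_ <= X)%N]mulnC [X in (_ <= X)%N]mulnA.
  by rewrite leq_mul2l ho orbT.
have : (r.+1 ^ (4 * N) * q ^ (N * N) * (r + c) ^ 4 <=
        D ^ 4 * q ^ (3 * N) * r ^ (2 * N))%N.
  have hN : (r.+1 ^ (4 * N) <= r ^ (2 * N) * r ^ (2 * N) * q ^ (3 * N))%N.
    have := leq_exp2r (r.+1 ^ 4) (r ^ 4 * q ^ 3) (e := N).
    rewrite -expnD -mulnDl !expnM -expnMn.
    by case: (N) => [|N'] // ->.
  have hD4 : ((r ^ m * q ^ (k * m)) ^ 4 * (r + c) ^ 4 <= D ^ 4)%N.
    by rewrite -expnMn leq_exp2r.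
  apply: (leq_trans (leq_mul (leq_mul hN (leqnn _)) (leqnn _))).
  apply: (@leq_trans (q ^ (N * N) * r ^ (2 * N) * (r + c) ^ 4
                      * (q ^ (3 * N) * r ^ (2 * N)))%N); first by lia.
  rewrite -[X in (_ <= X)%N]mulnA leq_mul2r; apply/orP; right.
  by apply: leq_trans hD4; rewrite leq_mul2r hX orbT.
rewrite -(ler_nat R) !(natrM, natrX) -[r.+1]addn1 natrD => h.
apply: (le_trans h); rewrite ler_peMr ?mulr_ge0 ?exprn_ge0 //.
by rewrite exprn_ege1 // lerDr.
Qed.

Lemma lower_bound_of_fourth_power (R : realType) (r q y w L : R) (N : nat) :
  0 < r -> 1 < q -> 0 <= y -> 0 <= w -> 0 <= L ->
  (r + 1) ^+ (4 * N) * q ^+ (N * N) * w ^+ 4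
    <= L ^+ 4 * q ^+ (3 * N) * r ^+ (2 * N) * (y + 1) ^+ (4 * N) ->
  w * ((r + 1) / (Num.sqrt r * (y + 1))) ^+ N
    * q `^ (N%:R * (N%:R - 3) / 4) <= L.
Proof.
move=> r0 q1 y0 w0 L0 hL.
have q0 : 0 < q by apply: lt_trans q1.
have y1 : 0 < y + 1 by rewrite ltr_wpDl.
have s0 : 0 < Num.sqrt r by rewrite sqrtr_gt0.
set T := (_ * _ * _).
have T0 : 0 <= T.
  rewrite !mulr_ge0 ?powR_ge0 ?exprn_ge0 // divr_ge0 ?mulr_ge0 ?ltW //.
  by rewrite ltr_wpDl // ltW.
rewrite -(@ler_pXn2r _ 4) // ?nnegrE //.
(* The exponent [N ^ 2 - 3 N] can be negative, so [q ^+ (3 * N)] is moved across to leave only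
   natural powers. *)
have q4 : (q `^ (N%:R * (N%:R - 3) / 4)) ^+ 4 * q ^+ (3 * N) = q ^+ (N * N).
  rewrite -!powR_mulrn ?powR_ge0 ?ltW // -powRrM -powRD; last first.
    by rewrite (gt_eqF q0) implybT.
  by congr (_ `^ _); rewrite !natrM; field.
have s4 : Num.sqrt r ^+ (4 * N) = r ^+ (2 * N).
  by rewrite -{2}(sqr_sqrtr (ltW r0)) -exprM mulnA.
have pos : 0 < q ^+ (3 * N) * r ^+ (2 * N) * (y + 1) ^+ (4 * N).
  by rewrite !mulr_gt0 ?exprn_gt0.
rewrite -(ler_pM2r pos) !mulrA; apply: le_trans hL.
rewrite /T !exprMn -q4 -s4 -!exprM ![(N * 4)%N]mulnC exprVn exprMn.
rewrite le_eqVlt; apply/orP; left; apply/eqP.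
by field; rewrite ?expf_neq0 ?gt_eqF.
Qed.

Theorem corollary1p4 (R : realType) (q a b : int) (v : nat -> nat)
    (hq : 2 <= q) (ha : 1 <= a) (hb : - a <= b)
    (hv : forall n : nat, (v n)%:Z = a * q ^+ n + b)
    (hgcd1 : gcdz (a * q) b = 1) (hgcd2 : gcdz (a + b) (q - 1) = 1)
    (n : nat) (hn : (0 < n)%N) :
  (a * q + b)%:~R
    * ((a%:~R * (q%:~R - 1) + 1)
       / (Num.sqrt (a%:~R * (q%:~R - 1)) * (Aprime R q a b + 1))) ^+ (n - 1)
    * q%:~R `^ ((n%:R - 1) * (n%:R - 4) / 4)
  <= (lcm_upto v n)%:R :> R.
Proof.
case: q hq hv hgcd1 hgcd2 => // q; case: a ha hb => // a ha hb hq hv hgcd1 hgcd2.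
case: q hq hv hgcd1 hgcd2 => // p hq hv hgcd1 hgcd2.
have a0 : (0 < a)%N by lia.
(* Here [p] is [q - 1], and [c] is [v_0], where [b >= -a] makes the absolute value harmless. *)
pose r := (a * p)%N; pose c := absz (a%:Z + b).
have cE : c%:Z = a%:Z + b by rewrite /c gez0_abs //; lia.
have bE : b = c%:Z - a%:Z by rewrite cE; ring.
have vE i : v i = qarith p.+1 r c i.
  apply/eqP; rewrite -eqz_nat hv bE -[Posz p.+1]natz -natrX natz; apply/eqP.
  rewrite -qintE /qarith /r; lia.
have r0 : (0 < r)%N by rewrite muln_gt0 a0.
have [copa copp] : coprimez a b /\ coprimez p.+1 b.
  by apply/andP; rewrite -coprimezMl /coprimez hgcd1.
(* [r + c] is [v_1 = a q + b], congruent to [b] modulo [q]. *)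
have copq : coprime p.+1 (r + c).
  have -> : coprime p.+1 (r + c) = coprimez p.+1 (a%:Z * p.+1%:Z + b).
    by rewrite coprimezE; congr coprime; rewrite bE /r; lia.
  by rewrite /coprimez gcdzMDl.
have coprc : coprime r c.
  have -> : coprime r c = coprimez (a%:Z * p%:Z) (a%:Z + b).
    by rewrite -cE coprimezE.
  rewrite coprimezMl; apply/andP; split.
    by rewrite /coprimez gcdzDl.
  by rewrite coprimez_sym; apply/eqP; rewrite -hgcd2; congr gcdz; lia.
case: n hn => // N _.
have L0 : (0 < lcm_upto v N.+1)%N.
  apply: lcm_upto_gt0 => -[|i] // _.
  by rewrite vE ltn_addr // muln_gt0 r0 qint_gt0.
have hL : (r ^ uphalf N * p.+1 ^ (N./2 * uphalf N) * qarith p.+1 r c N.+1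
           <= lcm_upto v N.+1)%N.
  have NE : (N./2 + uphalf N = N)%N.
    by rewrite addnC uphalf_half -addnA addnn odd_double_half.
  have h i : (i <= uphalf N)%N ->
      (qarith p.+1 r c ((N./2).+1 + i) %| lcm_upto v N.+1)%N.
    by move=> hi; rewrite -vE dvdn_lcm_upto //; lia.
  by have := qarith_lcm_bound coprc copq L0 h; rewrite NE.
have rE : a%:~R * (p.+1%:~R - 1) = r%:R :> R.
  by rewrite /r natrM -!pmulrn -addn1 natrD addrK.
have wE : (a%:Z * p.+1%:Z + b)%:~R = (r + c)%:R :> R.
  by rewrite pmulrn; congr (_%:~R); rewrite bE /r; lia.
have A0 : 0 <= Aprime R p.+1 a b by rewrite le_max lexx.
rewrite rE wE subn1 /=.
have -> : (N.+1%:R - 1) * (N.+1%:R - 4) / 4 = N%:R * (N%:R - 3) / 4 :> R.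
  by rewrite -addn1 natrD; field.
apply: lower_bound_of_fourth_power => //.
- by rewrite ltr0n.
- by rewrite -pmulrn ltr1n.
rewrite -pmulrn; apply: fourth_power_bound => //.
  by rewrite ltnS leq_pmull.
move=> r1; have [a1 p1] : a = 1%N /\ p = 1%N by move: r1; rewrite /r; nia.
case: (posnP c) => [->|c0]; [by left | right].
(* With [r = 1] and [q = 2], the value [c = 1] would make [r + c] even. So [c >= 2], and the second
   argument of the maximum in [Aprime] equals [c / 2 >= 1]. *)
have c2 : (1 < c)%N.
  rewrite ltn_neqAle c0 andbT; apply/eqP => c1.
  by move: copq; rewrite r1 p1 -c1.
rewrite le_max; apply/orP; right; rewrite bE a1 p1 rmorphB /=.
have : (2 : R) <= c%:R by rewrite ler_nat.
rewrite -!pmulrn => hc.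
have -> : (c%:R - 1) / (2 * 1) + 1 / (2 * 1 * (2 - 1)) = c%:R / 2 :> R by field.
by rewrite ler_pdivlMr // mul1r.
Qed.
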